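(* Let $$A_{fb}=\begin{bmatrix}A_{aug}&-B_{aug}C_C\\ B_CC_{aug}&A_C\end{bmatrix}\in\mathbb{R}^{(3n+2N)\times(3n+2N)}$$ be the state matrix of the feedback system in which the plant, with the time delay replaced by the Padé approximation, is controlled by the compensator $(A_C,B_C,C_C)$. The eigenvalues of $A_{fb}$ are the union (counted with multiplicity) of the eigenvalues of $A$, $A-BK$, $A-LC$, and $A_N$, with the latter having multiplicity two (i.e. the eigenvalues of $A_N$ are counted twice).
   Context: Let $n,N\ge1$ be integers, $\tau>0$, $A\in\mathbb{R}^{n\times n}$, $B,E\in\mathbb{R}^{n\times1}$, $C\in\mathbb{R}^{1\times n}$, with $(A,C)$ observable and $(A,B)$, $(A,E)$ controllable. $K\in\mathbb{R}^{1\times n}$ is a state feedback gain. $L=\Sigma C^TW^{-1}\in\mathbb{R}^{n}$ is the optimal estimator gain, where $V\ge0$, $W>0$ are scalars and $\Sigma$ is the unique positive definite solution of $0=A\Sigma+\Sigma A^T-\Sigma C^TW^{-1}C\Sigma+EVE^T$. $P_N(s)$ denotes the $N$-th order (diagonal) Padé approximation of $e^{-s\tau}$: $P_N(s)=Q_N(-s)/Q_N(s)$ with $Q_N(s)=\sum_{k=0}^N\frac{(2N-k)!\,N!}{(2N)!\,k!\,(N-k)!}(\tau s)^k$; $(A_N,B_N,C_N,D_N)$ is a minimal real realization, $P_N(s)=C_N(sI_N-A_N)^{-1}B_N+D_N$, $A_N\in\mathbb{R}^{N\times N}$. Define $$A_{aug}=\begin{bmatrix}A&0_{n\times N}\\ B_NC&A_N\end{bmatrix},\quad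 B_{aug}=\begin{bmatrix}B\\ 0_{N\times1}\end{bmatrix},\quad C_{aug}=\begin{bmatrix}D_NC&C_N\end{bmatrix},$$ $$A_C=\begin{bmatrix}A-LC&-LD_NC&-LC_N\\ -BK&A-BK&0_{n\times N}\\ 0_{N\times n}&B_NC&A_N\end{bmatrix},\quad B_C=\begin{bmatrix}L\\ 0_{n\times1}\\ 0_{N\times1}\end{bmatrix},\quad C_C=\begin{bmatrix}K&K&0_{1\times N}\end{bmatrix}.$$ *)

(* Defs.v *)
From HB Require Import structures.
From mathcomp Require Import all_boot all_order all_algebra.
From mathcomp Require Import complex.
From mathcomp Require Import reals.

Set Implicit Arguments.
Unset Strict Implicit.
Unset Printing Implicit Defensive.

Import Order.TTheory GRing.Theory Num.Theory.

Local Open Scope ring_scope.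

(** * Linear systems *)

(* Kalman's definitions: [B, AB, ..., A^(n-1) B] has full row rank, and
   the stack of C, CA, ..., C A^(n-1) has full column rank. *)
Definition controllable (F : fieldType) (n m : nat)
    (A : 'M[F]_n) (B : 'M[F]_(n, m)) : Prop :=
  \rank (\mxrow_(j < n) (A ^+ j *m B)) = n.

Definition observable (F : fieldType) (n p : nat)
    (A : 'M[F]_n) (C : 'M[F]_(p, n)) : Prop :=
  \rank (\mxcol_(i < n) (C *m A ^+ i)) = n.

Definition const_rational (F : fieldType) (c : F) : {fraction {poly F}} :=
  tofrac c%:P.

(* C (s I - A)^-1 B + D as a matrix of rational functions; s is the
   indeterminate, so that s I - A is always invertible. *)
Definition transfer_function (F : fieldType) (n m p : nat)
    (A : 'M[F]_n) (B : 'M[F]_(n, m)) (C : 'M[F]_(p, n)) (D : 'M[F]_(p, m)) :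
    'M[{fraction {poly F}}]_(p, m) :=
  let c k l (M : 'M[F]_(k, l)) := map_mx (@const_rational F) M in
  c _ _ C *m invmx ((tofrac 'X)%:M - c _ _ A) *m c _ _ B + c _ _ D.

Definition minimal_realization (F : fieldType) (n m p : nat)
    (G : 'M[{fraction {poly F}}]_(p, m))
    (A : 'M[F]_n) (B : 'M[F]_(n, m)) (C : 'M[F]_(p, n)) (D : 'M[F]_(p, m)) :
    Prop :=
  transfer_function A B C D = G /\
  forall (n' : nat) (A' : 'M[F]_n') (B' : 'M[F]_(n', m))
         (C' : 'M[F]_(p, n')) (D' : 'M[F]_(p, m)),
    transfer_function A' B' C' D' = G -> (n <= n')%N.

(** * Pade approximation of the delay exp(- s tau) *)

Definition pade_den (F : fieldType) (N : nat) (tau : F) : {poly F} :=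
  \sum_(k < N.+1)
    (((2 * N - k)`! * N`!)%:R / ((2 * N)`! * k`! * (N - k)`!)%:R : F)
      *: (tau *: 'X) ^+ k.

Definition pade (F : fieldType) (N : nat) (tau : F) : {fraction {poly F}} :=
  tofrac (pade_den N tau \Po (- 'X)) / tofrac (pade_den N tau).

(** * Optimal estimator *)

Definition positive_definite (R : realType) (n : nat) (S : 'M[R]_n) : Prop :=
  S^T = S /\ forall x : 'cV[R]_n, x != 0 -> 0 < (x^T *m S *m x) 0 0.

Definition filter_riccati (R : realType) (n : nat)
    (A : 'M[R]_n) (C : 'rV[R]_n) (E : 'cV[R]_n) (V W : R) (S : 'M[R]_n) : Prop :=
  0 = A *m S + S *m A^T - S *m C^T *m (W^-1)%:M *m C *m S
      + E *m V%:M *m E^T.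

Definition estimator_gain (R : realType) (n : nat)
    (C : 'rV[R]_n) (W : R) (S : 'M[R]_n) : 'cV[R]_n :=
  S *m C^T *m (W^-1)%:M.

(** * The feedback system *)

Definition A_aug (F : fieldType) (n N : nat) (A : 'M[F]_n) (C : 'rV[F]_n)
    (A_N : 'M[F]_N) (B_N : 'cV[F]_N) : 'M[F]_(n + N) :=
  block_mx A 0 (B_N *m C) A_N.

Definition B_aug (F : fieldType) (n N : nat) (B : 'cV[F]_n) : 'cV[F]_(n + N) :=
  col_mx B 0.

Definition C_aug (F : fieldType) (n N : nat) (C : 'rV[F]_n)
    (C_N : 'rV[F]_N) (D_N : 'M[F]_1) : 'rV[F]_(n + N) :=
  row_mx (D_N *m C) C_N.

Definition A_C (F : fieldType) (n N : nat)
    (A : 'M[F]_n) (B : 'cV[F]_n) (C : 'rV[F]_n) (K : 'rV[F]_n) (L : 'cV[F]_n)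
    (A_N : 'M[F]_N) (B_N : 'cV[F]_N) (C_N : 'rV[F]_N) (D_N : 'M[F]_1) :
    'M[F]_(n + (n + N)) :=
  block_mx (A - L *m C)   (row_mx (- (L *m D_N *m C)) (- (L *m C_N)))
           (col_mx (- (B *m K))
                   0)     (block_mx (A - B *m K)  0
                                    (B_N *m C)    A_N).

Definition B_C (F : fieldType) (n N : nat) (L : 'cV[F]_n) :
    'cV[F]_(n + (n + N)) :=
  col_mx L (col_mx 0 0).

Definition C_C (F : fieldType) (n N : nat) (K : 'rV[F]_n) :
    'rV[F]_(n + (n + N)) :=
  row_mx K (row_mx K 0).

Definition A_fb (F : fieldType) (n N : nat)
    (A : 'M[F]_n) (B : 'cV[F]_n) (C : 'rV[F]_n) (K : 'rV[F]_n) (L : 'cV[F]_n)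
    (A_N : 'M[F]_N) (B_N : 'cV[F]_N) (C_N : 'rV[F]_N) (D_N : 'M[F]_1) :
    'M[F]_((n + N) + (n + (n + N))) :=
  block_mx (A_aug A C A_N B_N)
           (- (B_aug N B *m C_C N K))
           (B_C N L *m C_aug C C_N D_N)
           (A_C A B C K L A_N B_N C_N D_N).

(** * Eigenvalues of a real matrix *)

(* The complex roots of the characteristic polynomial, each repeated
   according to its algebraic multiplicity; the order is irrelevant, so these
   lists are to be compared with [perm_eq]. *)
Definition eigenvalues (R : realType) (n : nat) (M : 'M[R]_n) : seq R[i] :=
  sval (closed_field_poly_normal (char_poly (map_mx (real_complex R) M))).

Lemma char_poly_eigenvalues (R : realType) (n : nat) (M : 'M[R]_n) :
  char_poly (map_mx (real_complex R) M)
    = \prod_(z <- eigenvalues M) ('X - z%:P).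
Proof.
rewrite /eigenvalues; case: closed_field_poly_normal => s /= {1}->.
by rewrite (monicP (char_poly_monic _)) scale1r.
Qed.

Lemma mem_eigenvalues (R : realType) (n : nat) (M : 'M[R]_n) (z : R[i]) :
  (z \in eigenvalues M) = eigenvalue (map_mx (real_complex R) M) z.
Proof.
by rewrite eigenvalue_root_char char_poly_eigenvalues root_prod_XsubC.
Qed.

Lemma count_eigenvalues (R : realType) (n : nat) (M : 'M[R]_n) (z : R[i]) :
  count_mem z (eigenvalues M)
    = mup z (char_poly (map_mx (real_complex R) M)).
Proof. by rewrite char_poly_eigenvalues mu_prod_XsubC. Qed.

(* Main.v *)
Require Import Defs.
From mathcomp Require Import all_boot all_order all_algebra.
From mathcomp Require Import complex.
From mathcomp Require Import reals.

(** In the coordinates (x - z, p - q, e, z, q), where (x, p) is the state of the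
plant and of its delay, e the estimation part of the compensator state, and
(z, q) the copy of the plant and the delay that the compensator carries, the
closed loop is block lower triangular.  Indeed the input [- B K (e + z)] drives
x and z alike, so it drops out of the difference (x - z, p - q), which then
evolves freely by [A_aug]; and the measurements of the two systems enter
the equation of e only through their difference, so that (e, z, q) is left with
the blocks [A - L C], [A - B K] and [A_N], coupled as a cascade
([A_fb_intertwine]).  Since [A_aug] is itself a cascade of [A] and [A_N], the
characteristic polynomial of [A_fb] is the product of the five expected ones
([char_poly_A_fb]), and unique factorization into linear factors over the
complex numbers turns this into an equality of multisets of roots. *)

Set Implicit Arguments.
Unset Strict Implicit.
Unset Printing Implicit Defensive.

Import Order.TTheory GRing.Theory Num.Theory.

Local Open Scope ring_scope.

Lemma char_poly_lblock (R : comNzRingType) (m n : nat)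
    (A : 'M[R]_m) (C : 'M[R]_(n, m)) (B : 'M[R]_n) :
  char_poly (block_mx A 0 C B) = char_poly A * char_poly B.
Proof.
rewrite /char_poly -(det_lblock _ (- map_mx polyC C)); congr (\det _).
by rewrite /char_poly_mx map_block_mx map_mx0 scalar_mx_block
  opp_block_mx add_block_mx !(oppr0, addr0, add0r).
Qed.

(** A change of basis is given by an intertwining relation rather than by a
conjugation, so that the inverse of the change of basis never has to be
computed. *)
Lemma char_poly_intertwine (R : comNzRingType) (n : nat) (T M M' : 'M[R]_n) :
  \det T = 1 -> T *m M = M' *m T -> char_poly M = char_poly M'.
Proof.
move=> detT eqTM; pose Tp := map_mx polyC T.
have detTp : \det Tp = 1 by rewrite det_map_mx detT.
have: Tp *m char_poly_mx M = char_poly_mx M' *m Tp.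
  by rewrite /char_poly_mx mulmxBr mulmxBl -!map_mxM eqTM scalar_mxC.
by move/(congr1 determinant); rewrite !det_mulmx detTp mul1r mulr1.
Qed.

Section ClosedLoop.

Variables (F : fieldType) (n N : nat).
Variables (A : 'M[F]_n) (B L : 'cV[F]_n) (C K : 'rV[F]_n).
Variables (A_N : 'M[F]_N) (B_N : 'cV[F]_N) (C_N : 'rV[F]_N) (D_N : 'M[F]_1).

(** The map (x, p, e, z, q) |-> (x - z, p - q, e, z, q). *)
Definition subtract_copy : 'M[F]_((n + N) + (n + (n + N))) :=
  block_mx 1%:M (row_mx 0 (- 1%:M)) 0 1%:M.

(** The compensator dynamics of (e, z, q) when the measurement equals the output
of the internal copy, so that the two cancel in the equation of e. *)
Definition A_comp_exact : 'M[F]_(n + (n + N)) :=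
  block_mx (A - L *m C) 0
           (col_mx (- (B *m K)) 0) (block_mx (A - B *m K) 0 (B_N *m C) A_N).

Definition A_fb_triangular : 'M[F]_((n + N) + (n + (n + N))) :=
  block_mx (A_aug A C A_N B_N) 0 (B_C N L *m C_aug C C_N D_N) A_comp_exact.

Lemma det_subtract_copy : \det subtract_copy = 1.
Proof. by rewrite det_ublock !det1 mulr1. Qed.

Lemma A_fb_intertwine :
  subtract_copy *m A_fb A B C K L A_N B_N C_N D_N
    = A_fb_triangular *m subtract_copy.
Proof.
rewrite /subtract_copy /A_fb /A_fb_triangular !mulmx_block.
rewrite !(mul1mx, mulmx1, mul0mx, mulmx0, addr0, add0r).
congr block_mx.
-
  (* The measurement acts on e only, not on the copy (z, q). *)
  by rewrite mulmxA mul_row_col mul0mx add0r col_mx0 mulmx0 mul0mx addr0.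
-
  (* The control input reaches x and z through the same term. *)
  rewrite /A_C /B_aug /C_C block_mxEv mul_row_col mul0mx add0r mulNmx mul1mx.
  rewrite !mul_mx_row !mulmx0 mulmxN mulmx1 /A_aug.
  rewrite !mul_col_mx !mul0mx !opp_row_mx !add_row_mx.
  rewrite !block_mxEh !opp_row_mx !add_row_mx !opp_col_mx !add_col_mx.
  by rewrite !(oppr0, addr0, add0r, opprK, addNr) opprB addKr col_mx0.
-
  (* The compensator subtracts the output of its copy from the measurement. *)
  rewrite /A_C /A_comp_exact /B_C /C_aug !mul_col_row !mul_col_mx.
  rewrite !mul0mx !col_mx0 row_mx0 !mulmx0 mul0mx mulmxN mulmx1.
  by rewrite opp_row_mx mulmxA add_block_mx !(add0r, addr0).
Qed.

Lemma char_poly_A_fb :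
  char_poly (A_fb A B C K L A_N B_N C_N D_N) =
    char_poly A * char_poly A_N *
    (char_poly (A - L *m C) * (char_poly (A - B *m K) * char_poly A_N)).
Proof.
rewrite (char_poly_intertwine det_subtract_copy A_fb_intertwine).
by rewrite !char_poly_lblock.
Qed.

End ClosedLoop.

Theorem mainTheorem10 (R : realType) (n N : nat) (hn : (1 <= n)%N)
    (hN : (1 <= N)%N) (tau : R) (htau : 0 < tau)
    (A : 'M[R]_n) (B E : 'cV[R]_n) (C : 'rV[R]_n)
    (hAC : observable A C) (hAB : controllable A B) (hAE : controllable A E)
    (K : 'rV[R]_n)
    (V W : R) (hV : 0 <= V) (hW : 0 < W)
    (Sigma : 'M[R]_n)
    (hSigma : unique (fun S => positive_definite S /\
                               filter_riccati A C E V W S) Sigma)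
    (L : 'cV[R]_n) (hL : L = estimator_gain C W Sigma)
    (A_N : 'M[R]_N) (B_N : 'cV[R]_N) (C_N : 'rV[R]_N) (D_N : 'M[R]_1)
    (hP : minimal_realization (pade N tau)%:M A_N B_N C_N D_N) :
  perm_eq (eigenvalues (A_fb A B C K L A_N B_N C_N D_N))
          (eigenvalues A ++ eigenvalues (A - B *m K) ++
           eigenvalues (A - L *m C) ++ eigenvalues A_N ++ eigenvalues A_N).
Proof.
apply: prod_XsubC_eq; rewrite !big_cat /= -!char_poly_eigenvalues.
rewrite -!map_char_poly char_poly_A_fb !rmorphM /=.
by rewrite -mulrA; congr (_ * _); rewrite mulrC -!mulrA mulrCA.
Qed.
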